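(* Let $f_r(x)=\sum_{n=0}^\infty r^{-n}\phi(r^n x)$, where $\phi(x)=\operatorname{dist}(x,\mathbb{Z})$, and for $y\in\mathbb{R}$ let $L_r(y)=\{x\in[0,1): f_r(x)=y\}$. Then: (i) For each integer $r\geq 2$ and for almost every $y\in\mathbb{R}$, the set $L_r(y)$ is finite. (ii) For each integer $r\geq 2$ and for almost every $x\in[0,1)$, the set $L_r(f_r(x))$ is uncountable.
   Context: $\phi(x)=\operatorname{dist}(x,\mathbb{Z})$ is the distance from the real number $x$ to the nearest integer. ''Almost every'' is meant with respect to Lebesgue measure. The empty set counts as finite. *)

(* Defs.v *)
From HB Require Import structures.
From mathcomp Require Import all_boot all_order all_algebra.
From mathcomp Require Import all_classical all_reals all_analysis.

Set Implicit Arguments.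
Unset Strict Implicit.
Unset Printing Implicit Defensive.

Import Order.TTheory GRing.Theory Num.Theory.
Import numFieldNormedType.Exports.

Local Open Scope classical_set_scope.
Local Open Scope ring_scope.

Definition dist_int (R : realType) (x : R) : R :=
  inf [set `|x - m%:~R| | m in [set: int]].

(* The terms are nonnegative and bounded by r ^- n, so for r >= 2 the partial
   sums converge and the limit below is a genuine one. *)
Definition takagi (R : realType) (r : nat) (x : R) : R :=
  limn (series (fun n : nat => r%:R ^- n * dist_int (r%:R ^+ n * x))).

Definition level_set (R : realType) (r : nat) (y : R) : set R :=
  [set x | 0 <= x < 1 /\ takagi r x = y].

(* Main.v *)
Require Import Defs.
From HB Require Import structures.
From mathcomp Require Import all_boot all_order all_algebra.
From mathcomp Require Import all_classical all_reals all_analysis.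
From mathcomp Require Import measurable_realfun.
From mathcomp Require Import zify ring lra.

(* On [0, 1] the function [g u = f (u / 2)] satisfies [g u = u / 2 + g (T u) / r]
   where [T] is the [r]-fold zigzag map, with inverse branches [branch d].  Hence
   over an interval of order [n] the graph of [g] is an affine image of
   [t |-> s / 2 * t + g t], where the integer [s] performs a walk: passing to the
   [d]-th subinterval replaces [s] by [(-1) ^ d * (s + 1)].  When [s = -1] the
   [r] subintervals carry identical pieces of graph.

   (i) Count the pieces of order [n] whose range contains [y], but divide by
   [2 r / 3] at each visit of [s = -1].  The increments of [g] give a harmonic
   function of the walk, from which one builds a superharmonic bound for the
   integral over [y] of this count; by Fatou the count has a finite lower limit
   for almost every [y].  If the level set is infinite, then the count tends to
   infinity: at every branching of the level set it grows, and at every visit of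
   [s = -1] the [r] identical pieces together count [3 / 2] times one of them.

   (ii) The walk is recurrent: a bounded function that is harmonic for it, up to
   a factor [1 / 2] at [-1], is zero.  So almost every point visits [s = -1]
   infinitely often, and at each visit the rest of its itinerary can be
   transplanted to another subinterval without changing the value of [g].  This
   gives enough freedom to avoid any sequence of points by nested intervals. *)

Set Implicit Arguments.
Unset Strict Implicit.
Unset Printing Implicit Defensive.

Import Order.TTheory GRing.Theory Num.Theory.
Import numFieldNormedType.Exports.

Local Open Scope classical_set_scope.
Local Open Scope ring_scope.

(** * The distance to the nearest integer and the functions [f_r] *)

Section dist_int.
Context {R : realType}.
Implicit Types x : R.

Lemma dist_int_le x (m : int) : dist_int x <= `|x - m%:~R|.
Proof.
apply: ge_inf; last by exists m.
by exists 0 => _ [k _ <-].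
Qed.

Lemma le_dist_int x (c : R) :
  (forall m : int, c <= `|x - m%:~R|) -> c <= dist_int x.
Proof.
move=> cx; apply: lb_le_inf; first by exists `|x - 0%:~R|, 0.
by move=> _ [m _ <-].
Qed.

Lemma dist_int_ge0 x : 0 <= dist_int x.
Proof. by apply: le_dist_int. Qed.

Lemma dist_int_le_half x : dist_int x <= 2^-1.
Proof.
have /andP[fx xf] := real_floor_itv (num_real x).
rewrite intrD in xf.
have [xh|xh] := leP (x - (Num.floor x)%:~R) 2^-1.
  by apply: le_trans (dist_int_le x (Num.floor x)) _; rewrite ger0_norm; lra.
apply: le_trans (dist_int_le x (Num.floor x + 1)) _.
rewrite intrD ler0_norm; lra.
Qed.

Lemma dist_intDz x (k : int) : dist_int (x + k%:~R) = dist_int x.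
Proof.
apply/eqP; rewrite eq_le; apply/andP; split; apply: le_dist_int => m.
  have -> : x - m%:~R = (x + k%:~R) - (m + k)%:~R by rewrite intrD; ring.
  exact: dist_int_le.
have -> : (x + k%:~R) - m%:~R = x - (m - k)%:~R by rewrite intrB; ring.
exact: dist_int_le.
Qed.

Lemma dist_intN x : dist_int (- x) = dist_int x.
Proof.
apply/eqP; rewrite eq_le; apply/andP; split; apply: le_dist_int => m.
  have -> : `|x - m%:~R| = `|- x - (- m)%:~R|.
    by rewrite -normrN intrN; congr `|_|; ring.
  exact: dist_int_le.
have -> : `|- x - m%:~R| = `|x - (- m)%:~R|.
  by rewrite -normrN intrN; congr `|_|; ring.
exact: dist_int_le.
Qed.

Lemma dist_int_id x : 0 <= x <= 2^-1 -> dist_int x = x.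
Proof.
move=> /andP[x0 x1]; apply/eqP; rewrite eq_le; apply/andP; split.
  by apply: le_trans (dist_int_le x 0) _; rewrite subr0 ger0_norm.
apply: le_dist_int => m; have [m0|m0] := lerP m 0.
  have : m%:~R <= 0 :> R by rewrite lerz0.
  by move=> mR; rewrite ger0_norm; lra.
have : 1 <= m%:~R :> R by rewrite -[1]/(1%:~R) ler_int; lia.
by move=> mR; rewrite ler0_norm; lra.
Qed.

End dist_int.

Section takagi.
Context {R : realType} (r : nat).
Hypothesis r2 : (2 <= r)%N.
Implicit Types x : R.
Local Notation f := (@takagi R r).
Local Notation term := (fun x n => r%:R ^- n * dist_int (r%:R ^+ n * x) : R).

Let r_gt0 : 0 < r%:R :> R. Proof. by rewrite ltr0n; lia. Qed.

Lemma takagi_term_ge0 x n : 0 <= term x n.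
Proof. by rewrite mulr_ge0 ?dist_int_ge0// invr_ge0 exprn_ge0 ?ltW. Qed.

Lemma takagi_series_le1 x n : series (term x) n <= 1.
Proof.
(* The slack [2^-1 ^+ n] makes the induction close: each term is at most half of it, since [r >= 2]
   and [dist_int <= 2^-1]. *)
suff : series (term x) n + 2^-1 ^+ n <= 1.
  by apply: le_trans; rewrite lerDl exprn_ge0// invr_ge0.
elim: n => [|n IHn]; first by rewrite /series/= big_geq// expr0 add0r.
apply: le_trans IHn; rewrite /series/= big_nat_recr//= -addrA lerD2l.
have : term x n <= 2^-1 ^+ n * 2^-1.
  apply: ler_pM; rewrite ?dist_int_ge0 ?dist_int_le_half ?invr_ge0 ?exprn_ge0//.
  rewrite -exprVn; apply: lerXn2r; rewrite ?nnegrE ?invr_ge0 ?ler0n//.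
  by rewrite lef_pV2 ?posrE ?ltr0n// ?ler_nat//; lia.
by rewrite exprS; lra.
Qed.

Lemma is_cvg_takagi x : cvgn (series (term x)).
Proof.
apply: nondecreasing_is_cvgn.
  exact/nondecreasing_series/(fun n _ _ => takagi_term_ge0 x n).
by exists 1 => _ [n _ <-]; exact: takagi_series_le1.
Qed.

Lemma takagi_ge0 x : 0 <= f x.
Proof.
apply: limr_ge; first exact: is_cvg_takagi.
by apply: nearW => n; apply: sumr_ge0 => k _; exact: takagi_term_ge0.
Qed.

Lemma takagi_le1 x : f x <= 1.
Proof.
apply: limr_le; first exact: is_cvg_takagi.
by apply: nearW => n; exact: takagi_series_le1.
Qed.

Lemma takagiDz x (k : int) : f (x + k%:~R) = f x.
Proof.
rewrite /takagi; congr (limn (series _)); apply/funext => n.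
have -> : r%:R ^+ n * (x + k%:~R) = r%:R ^+ n * x + ((r%:Z) ^+ n * k)%:~R.
  by rewrite mulrDr intrM rmorphXn.
by rewrite dist_intDz.
Qed.

Lemma takagiN x : f (- x) = f x.
Proof.
rewrite /takagi; congr (limn (series _)); apply/funext => n.
have -> : r%:R ^+ n * (- x) = - (r%:R ^+ n * x) by ring.
by rewrite dist_intN.
Qed.

Lemma takagi_rec x : f x = dist_int x + r%:R^-1 * f (r%:R * x).
Proof.
apply: cvg_lim => //; rewrite -(cvg_shiftS (series (term x))).
have -> : (fun n => series (term x) n.+1) =
    (fun n => dist_int x + r%:R^-1 * series (term (r%:R * x)) n).
  apply/funext => n; rewrite /series/= big_nat_recl//= expr0 invr1 !mul1r.
  congr (_ + _); rewrite big_distrr/=; apply: eq_bigr => k _.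
  rewrite exprS invfM -mulrA; congr (_ * (_ * dist_int _)); ring.
apply: cvgD; first exact: cvg_cst.
by apply: cvgM; [exact: cvg_cst|exact: is_cvg_takagi].
Qed.

End takagi.

(** * Lower limits of sequences of integrals *)

Section liminf_integral.
Context {d} {T : measurableType d} {R : realType}.
Variable mu : {measure set T -> \bar R}.
Variable F : nat -> T -> R.
Hypothesis mF : forall n, measurable_fun [set: T] (F n).
Hypothesis F0 : forall n x, 0 <= F n x.

Let mEF n : measurable_fun [set: T] (fun x => (F n x)%:E : \bar R).
Proof. exact/measurable_EFinP. Qed.

(** By Fatou's lemma the lower limit has integral at most [C], so it is finite almost everywhere. *)
Lemma ae_not_cvgy (C : R) :
  (forall n, (\int[mu]_x (F n x)%:E <= C%:E)%E) ->
  {ae mu, forall x, ~ F^~ x @ \oo --> +oo}.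
Proof.
move=> FC; pose G x := limn_einf (fun n => (F n x)%:E).
have G0 x : (0 <= G x)%E.
  rewrite /G limn_einf_lim; apply: lime_ge; first exact: is_cvg_einfs.
  by apply: nearW => n; apply: le_ereal_inf_tmp => _ [k _ <-]; rewrite lee_fin.
(* Measurability of the lower limit is taken from that of upper limits. *)
have GE : G = (\- (fun x => limn_esup (fun n => - (F n x)%:E)))%E.
  apply/funext => x; rewrite -limn_einfN; congr limn_einf.
  by apply/funext => n; rewrite /= opprK.
have mG : measurable_fun [set: T] G.
  rewrite GE; apply: measurableT_comp => //.
  by apply: measurable_fun_limn_esup => n; exact: measurableT_comp.
have iG : mu.-integrable [set: T] G.
  apply/integrableP; split=> //; apply: (@le_lt_trans _ _ C%:E); last exact: ltry.
  rewrite (eq_integral G); last by move=> x _; rewrite gee0_abs.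
  apply: le_trans (fatou mu measurableT mEF _) _.
    by move=> n x _; rewrite lee_fin.
  rewrite limn_einf_lim; apply: lime_le; first exact: is_cvg_einfs.
  apply: nearW => n; apply: ge_ereal_inf.
  by exists (\int[mu]_x (F n x)%:E)%E => //; exists n => /=.
apply: filterS (integrable_ae measurableT iG) => x /(_ I) Gfin /cvgryPge Fy.
have [Ge _] : (G x = +oo%E) * (limn_esup (fun n => (F n x)%:E) = +oo%E).
  apply: cvg_limn_einf_sup; apply/cvgeyPge => A.
  by apply: filterS (Fy A) => n; rewrite lee_fin.
by rewrite Ge in Gfin.
Qed.

(** By Markov's inequality the set where every [F n] is at least [e] has measure at most [B n / e]
    for each [n], hence is null. Countably many [e = 1 / (k + 1)] suffice. *)
Lemma ae_liminf0 (B : nat -> R) :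
  (forall n, (\int[mu]_x (F n x)%:E <= (B n)%:E)%E) -> B @ \oo --> (0 : R) ->
  {ae mu, forall x (e : R), 0 < e -> exists n, F n x < e}.
Proof.
move=> FB B0.
suff aek k : {ae mu, forall x, exists n, F n x < k.+1%:R^-1}.
  apply: filterS (ae_foralln aek) => x xk e e0.
  have [k _ ke] : \forall k \near \oo, k.+1%:R^-1 < e :=
    near_infty_natSinv_lt (PosNum e0).
  have [n Fn] := xk k; exists n; apply: lt_trans Fn _; exact: (ke k (leqnn k)).
pose e : R := k.+1%:R^-1.
have e0 : 0 < e by rewrite invr_gt0.
pose A := \bigcap_n ([set: T] `&` [set x | (e%:E <= `|(F n x)%:E|)%E]).
have mA1 n : measurable ([set: T] `&` [set x | (e%:E <= `|(F n x)%:E|)%E]).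
  by apply: emeasurable_fun_c_infty => //; exact: measurableT_comp.
have mA : measurable A by exact: bigcap_measurableType.
exists A; split => //.
- apply/eqP; rewrite eq_le measure_ge0 andbT.
  apply/lee_addgt0Pr => eps eps0; rewrite add0e.
  have [n _ /(_ n (leqnn n)) Bn] : \forall n \near \oo, B n < e * eps.
    by apply: (cvgr_lt _ B0); rewrite mulr_gt0.
  rewrite -(@lee_pmul2l _ e%:E)//.
  apply: (@le_trans _ _ (\int[mu]_x `|(F n x)%:E|)%E).
    apply: le_trans (le_integral_abse mu measurableT (mEF n) e0).
    rewrite lee_pmul2l//; apply: le_measure; rewrite ?inE//.
    by move=> x; exact.
  rewrite (eq_integral (fun x => (F n x)%:E)); last first.
    by move=> x _; rewrite gee0_abs ?lee_fin.
  by apply: le_trans (FB n) _; rewrite -EFinM lee_fin ltW.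
- move=> x /= nx n _; split => //=; rewrite lee_fin ger0_norm// leNgt.
  by apply/negP => Fn; apply: nx; exists n.
Qed.

End liminf_integral.

(** * Weighted counts along a tree of intervals *)

Section weighted_count.
Context {R : realType} (r : nat) {S : Type}.
Variables (w lo hi : S -> R) (child : S -> nat -> S).
Hypothesis w0 : forall st, 0 <= w st.
Local Notation mu := (@lebesgue_measure R).

(** Counts the descendants of generation [n] whose interval contains [x], each with the product of
    the weights of its proper ancestors. Part (i) uses it on the value axis, part (ii) on the
    argument axis. *)
Fixpoint weighted_count n (st : S) (x : R) : R :=
  if n is n'.+1 then w st * \sum_(d < r) weighted_count n' (child st d) x
  else \1_(`[lo st, hi st]) x.
Local Notation cnt := weighted_count.

Lemma weighted_count0 st x : cnt 0%N st x = (lo st <= x <= hi st)%R%:R.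
Proof. by rewrite /= indicE mem_setE in_itv. Qed.

Lemma weighted_count_succ n st x :
  cnt n.+1 st x = w st * \sum_(d < r) cnt n (child st d) x.
Proof. by []. Qed.

Lemma weighted_count_ge0 n st x : 0 <= cnt n st x.
Proof.
elim: n st => [|n IHn] st /=; first by rewrite indicE.
by rewrite mulr_ge0// sumr_ge0.
Qed.

Lemma measurable_weighted_count n st : measurable_fun [set: R] (cnt n st).
Proof.
elim: n st => [|n IHn] st /=; first exact: measurable_indic.
by apply: measurable_funM => //; apply: measurable_sum.
Qed.

(** Integrating the recursion of the count gives the recursion imposed on [B], so induction on [n]
    over all states applies. *)
Lemma integral_weighted_count (B : nat -> S -> R) :
  (forall st, lo st <= hi st) -> (forall st, hi st - lo st <= B 0%N st) ->
  (forall n st, w st * \sum_(d < r) B n (child st d) <= B n.+1 st) ->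
  forall n st, (\int[mu]_x (cnt n st x)%:E <= (B n st)%:E)%E.
Proof.
move=> lohi B0 BS; elim=> [|n IHn] st /=.
  rewrite integral_indic// setIT.
  suff : (lebesgue_measure `[lo st, hi st]%classic <= (B 0%N st)%:E)%E by [].
  rewrite lebesgue_measure_itv/=.
  by case: ifPn => _; rewrite -?EFinB lee_fin//; move: (lohi st) (B0 st); lra.
under eq_integral do rewrite EFinM -sumEFin.
have mcnt d : measurable_fun [set: R] (fun x => (cnt n (child st d) x)%:E : \bar R).
  by apply/measurable_EFinP; exact: measurable_weighted_count.
have msum : measurable_fun [set: R]
    (fun x => (\sum_(d < r) (cnt n (child st d) x)%:E)%E : \bar R).
  exact: emeasurable_sum.
rewrite ge0_integralZl ?lee_fin//; last first.
  by move=> x _; apply: sume_ge0 => d _; rewrite lee_fin weighted_count_ge0.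
rewrite ge0_integral_sum//; last 2 first.
- by move=> d; exact: mcnt.
- by move=> d x _; rewrite lee_fin weighted_count_ge0.
apply: (@le_trans _ _ (w st * \sum_(d < r) B n (child st d))%:E).
  2: by rewrite lee_fin.
by rewrite EFinM -sumEFin lee_wpmul2l ?lee_fin//; apply: lee_sum.
Qed.

End weighted_count.

(** * The slope walk *)

Section branches.
Context {R : realType} (r : nat).
Hypothesis r2 : (2 <= r)%N.
Implicit Types (t u : R) (s : int) (d : nat).

(** This is [(d + t) / r] for even [d] and [(d + 1 - t) / r] for odd [d]. *)
Definition branch d t : R := ((d + odd d)%:R + (-1) ^+ d * t) / r%:R.

Definition turn s d : int := (-1) ^+ d * (s + 1).

Definition profile t : R := takagi r (t / 2).

Definition sloped s t : R := s%:~R / 2 * t + profile t.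

Lemma r_gt0 : 0 < r%:R :> R. Proof. by rewrite ltr0n; lia. Qed.

Lemma r_ge2 : 2 <= r%:R :> R. Proof. by rewrite ler_nat. Qed.

Lemma profile_ge0 t : 0 <= profile t.
Proof. exact: takagi_ge0. Qed.

Lemma profile_le1 t : profile t <= 1.
Proof. exact: takagi_le1. Qed.

Lemma branch_itv d t : (d < r)%N -> 0 <= t <= 1 -> 0 <= branch d t <= 1.
Proof.
move=> dr /andP[t0 t1]; have r0 := r_gt0.
have dR : d%:R + 1 <= r%:R :> R by rewrite natr1 ler_nat.
have d0 : 0 <= d%:R :> R by [].
rewrite /branch ler_pdivlMr// ler_pdivrMr// mul0r mul1r -signr_odd natrD.
by case: odd => /=; rewrite ?expr0 ?expr1; apply/andP; split; lra.
Qed.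

Lemma branch_surj u : 0 <= u <= 1 ->
  exists d t, [/\ (d < r)%N, 0 <= t <= 1 & u = branch d t].
Proof.
move=> /andP[u0 u1]; have r0 := r_gt0.
have ru0 : 0 <= r%:R * u by rewrite mulr_ge0// ltW.
(* The minimum matters only at [u = 1], which belongs to the last branch. *)
pose d := minn (Num.truncn (r%:R * u)) r.-1.
have dr : (d < r)%N by rewrite /d; lia.
have [fl fu] : d%:R <= r%:R * u /\ r%:R * u <= d%:R + 1.
  have /andP[tl tu] := truncn_itv ru0.
  rewrite /d /minn; case: ifPn => h.
    by split=> //; rewrite natr1 ltW.
  split.
    by apply: le_trans tl; rewrite ler_nat leqNgt.
  by rewrite natr1 prednK; [nra|lia].
exists d, (if odd d then d%:R + 1 - r%:R * u else r%:R * u - d%:R).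
split => //; first by case: odd; apply/andP; split; lra.
rewrite /branch -signr_odd natrD; case: odd => /=; rewrite ?expr0 ?expr1; field; lra.
Qed.

Lemma branch_dist d t t' : `|branch d t - branch d t'| = `|t - t'| / r%:R.
Proof.
have r0 := r_gt0.
have -> : branch d t - branch d t' = (-1) ^+ d * ((t - t') / r%:R).
  by rewrite /branch; ring.
by rewrite normrMsign normrM normfV normr_nat.
Qed.

(** On [[0, 1/2]] the distance to the integers is the identity, and multiplying [branch d t / 2] by
    [r] gives [t / 2] up to sign and an integer, neither of which affects [takagi]. *)
Lemma profile_branch d t : (d < r)%N -> 0 <= t <= 1 ->
  profile (branch d t) = branch d t / 2 + profile t / r%:R.
Proof.
move=> dr t01; have r0 := r_gt0; have /andP[b0 b1] := branch_itv dr t01.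
rewrite /profile takagi_rec// dist_int_id; last by apply/andP; split; lra.
congr (_ + _); rewrite mulrC; congr (_ / _).
have -> : r%:R * (branch d t / 2) = (-1) ^+ d * (t / 2) + ((uphalf d)%:Z)%:~R.
  have -> : ((uphalf d)%:Z)%:~R = (d + odd d)%:R / 2 :> R.
    have -> : (d + odd d)%N = (uphalf d * 2)%N.
      by rewrite uphalf_half -{1}(odd_double_half d); lia.
    by rewrite natrM mulfK.
  by rewrite /branch; field; lra.
rewrite takagiDz -signr_odd; case: odd; rewrite ?expr0 ?expr1 ?mul1r//.
by rewrite mulN1r takagiN.
Qed.

Lemma sloped_branch s d t : (d < r)%N -> 0 <= t <= 1 ->
  sloped s (branch d t) =
  (s + 1)%:~R * (d + odd d)%:R / (2 * r%:R) + sloped (turn s d) t / r%:R.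
Proof.
move=> dr t01; have r0 := r_gt0.
rewrite /sloped profile_branch// /turn intrM rmorph_sign intrD /branch.
by field; lra.
Qed.

Lemma turnN1 d : turn (- 1) d = 0.
Proof. by rewrite /turn addNr mulr0. Qed.

(** The [uphalf r] even digits lead to [s + 1], the [r./2] odd ones to [- (s + 1)]. *)
Lemma sum_turn (F : int -> R) s :
  \sum_(d < r) F (turn s d) =
  (uphalf r)%:R * F (s + 1) + (r./2)%:R * F (- (s + 1)).
Proof.
elim: r => [|n IHn]; first by rewrite big_ord0 !mul0r addr0.
rewrite big_ord_recr/= IHn /turn uphalf_half -signr_odd.
by case: odd => /=; rewrite ?expr0 ?expr1 ?mul1r ?mulN1r ?add0n ?add1n -?natr1; ring.
Qed.

End branches.

(** * Almost every level set is finite *)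

Section level_sets_finite.
Context {R : realType} (r : nat).
Hypothesis r2 : (2 <= r)%N.
Implicit Types (t u y c : R) (s : int) (d k : nat).

(* [(s, c, k)] stands for the graph piece [t |-> c + r^-k * sloped s t]. *)
Definition gchild (st : int * R * nat) d : int * R * nat :=
  let: (s, c, k) := st in
  (turn s d, c + r%:R ^- k * ((s + 1)%:~R * (d + odd d)%:R / (2 * r%:R)), k.+1).

(** [glo] and [ghi] enclose the range of the piece, using only [0 <= profile <= 1]; they need not be
    attained. *)
Definition glo (st : int * R * nat) : R :=
  let: (s, c, k) := st in c + r%:R ^- k * Num.min 0 (s%:~R / 2).

Definition ghi (st : int * R * nat) : R :=
  let: (s, c, k) := st in c + r%:R ^- k * (Num.max 0 (s%:~R / 2) + 1).

(* The [r] children of a piece with [s = -1] have the same image; the factor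
   [3 / (2 r)] makes them count for [3 / 2] together. *)
Definition gweight (st : int * R * nat) : R :=
  if st.1.1 == -1 then 3 / 2 / r%:R else 1.

Definition solutions (st : int * R * nat) y : set R :=
  [set t | 0 <= t <= 1 /\ st.1.2 + r%:R ^- st.2 * sloped r st.1.1 t = y].

Local Notation cnt := (weighted_count r gweight glo ghi gchild).

Let r0 : 0 < r%:R :> R. Proof. exact: r_gt0. Qed.

Let rk0 k : 0 < r%:R ^- k :> R. Proof. by rewrite invr_gt0 exprn_gt0. Qed.

Let rkS k : r%:R ^- k.+1 = r%:R ^- k / r%:R :> R.
Proof. by rewrite exprSr invfM mulrC. Qed.

Lemma gweight_ge0 st : 0 <= gweight st.
Proof. by rewrite /gweight; case: ifP => // _; rewrite !mulr_ge0// invr_ge0 ltW. Qed.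

Lemma glo_le_ghi st : glo st <= ghi st.
Proof.
move: st => [[s c] k]; rewrite lerD2l ler_pM2l//.
by apply: (@le_trans _ _ 0); rewrite ?ge_min ?lexx// addr_ge0// le_max lexx.
Qed.

Lemma solutions_branch st y d t : (d < r)%N -> 0 <= t <= 1 ->
  solutions st y (branch r d t) <-> solutions (gchild st d) y t.
Proof.
move: st => [[s c] k] dr t01; rewrite /solutions/= sloped_branch//.
have -> : c + r%:R ^- k * ((s + 1)%:~R * (d + odd d)%:R / (2 * r%:R) +
    sloped r (turn s d) t / r%:R) =
  c + r%:R ^- k * ((s + 1)%:~R * (d + odd d)%:R / (2 * r%:R)) +
    r%:R ^- k.+1 * sloped r (turn s d) t.
  by rewrite rkS; ring.
by split=> -[_ <-]; split => //; exact: branch_itv.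
Qed.

Lemma solutionsE st y : solutions st y =
  \bigcup_(d in `I_r) (branch r d @` solutions (gchild st d) y).
Proof.
apply/seteqP; split=> [u su|u [d /= dr [t st' <-]]].
  have [d [t [dr t01 ue]]] := branch_surj r2 su.1.
  exists d => //; exists t => //; apply/(solutions_branch _ _ dr t01).
  by rewrite -ue.
by apply/solutions_branch => //; exact: st'.1.
Qed.

Lemma gchildN1 c k d : gchild (-1, c, k) d = (0, c, k.+1).
Proof. by rewrite /gchild turnN1 addNr !mul0r mulr0 addr0. Qed.

Lemma weighted_countN1 n c k y :
  cnt n.+1 (-1, c, k) y = 3 / 2 * cnt n (0, c, k.+1) y.
Proof.
have wE : gweight (-1, c, k) = 3 / 2 / r%:R by rewrite /gweight eqxx.
rewrite weighted_count_succ wE (eq_bigr (fun=> cnt n (0, c, k.+1) y)); last first.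
  by move=> d _; rewrite gchildN1.
by rewrite sumr_const card_ord -[cnt _ _ _ *+ r]mulr_natl; field; rewrite lt0r_neq0.
Qed.

Lemma weighted_countS n s c k y : s != -1 ->
  cnt n.+1 (s, c, k) y = \sum_(d < r) cnt n (gchild (s, c, k) d) y.
Proof.
move=> s1; have wE : gweight (s, c, k) = 1 by rewrite /gweight (negPf s1).
by rewrite weighted_count_succ wE mul1r.
Qed.

(** A solution descends to some child, and at [s = -1] the total factor [3 / 2] only helps. *)
Lemma weighted_count_ge1 n st y : solutions st y !=set0 -> 1 <= cnt n st y.
Proof.
elim: n st => [|n IHn] [[s c] k] [u su].
  have [/= /andP[u0 u1] <-] := su.
  rewrite indicE mem_set//= in_itv/= !lerD2l !ler_pM2l// /sloped.
  have g0 := profile_ge0 r2 u; have g1 := profile_le1 r2 u.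
  rewrite /Num.min /Num.max; case: ltP => s0; apply/andP; split; nra.
have [d [t [dr t01 ue]]] := branch_surj r2 su.1.
have ct : solutions (gchild (s, c, k) d) y !=set0.
  by exists t; apply/solutions_branch => //; rewrite -ue.
have [sE|s1] := eqVneq s (-1).
  subst s; rewrite weighted_countN1.
  have /IHn : solutions (0, c, k.+1) y !=set0.
    by move: ct; rewrite gchildN1.
  lra.
rewrite weighted_countS// (bigD1 (Ordinal dr))//=.
apply: le_trans (IHn _ ct) _; rewrite lerDl; apply: sumr_ge0 => i _.
exact/weighted_count_ge0/gweight_ge0.
Qed.

Lemma solutions_infinite_child st y : infinite_set (solutions st y) ->
  exists2 d, (d < r)%N & infinite_set (solutions (gchild st d) y).
Proof.
move=> inf; apply: contrapT => nex; apply: inf; rewrite solutionsE.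
apply: bigcup_finite; first exact: finite_II.
move=> d /= dr; apply: finite_image; apply: contrapT => fin.
by apply: nex; exists d.
Qed.

(** Follow a child with infinitely many solutions until the count gains [1 / 2]: either [s = -1]
    occurs, or a second child also has a solution. Two distinct solutions bound the waiting time. *)
Lemma weighted_count_grows (j : nat) st y : infinite_set (solutions st y) ->
  exists n0, forall n, (n0 <= n)%N -> 1 + j%:R / 2 <= cnt n st y.
Proof.
elim: j st => [|j IHj] st inf.
  exists 0%N => n _; rewrite mul0r addr0; apply: weighted_count_ge1.
  exact: infinite_setN0.
have [u [u' [su su' uu']]] : exists u u',
    [/\ solutions st y u, solutions st y u' & u != u'].
  have [u su] := infinite_setN0 inf.
  have inf' : infinite_set (solutions st y `\ u).
    by apply: infinite_setD => //; exact: finite_set1.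
  have [u' [su' uu']] := infinite_setN0 inf'.
  by exists u, u'; split=> //; apply/eqP => uE; apply: uu'.
have [m um] : exists m, r%:R ^- m < `|u - u'|.
  have d0 : 0 < `|u - u'| by rewrite normr_gt0 subr_eq0.
  have [m _ /(_ m (leqnn m)) hm] :=
    near_infty_natSinv_expn_lt (PosNum d0).
  exists m; apply: le_lt_trans hm.
  rewrite mul1r lef_pV2 ?posrE ?exprn_gt0//.
  by rewrite lerXn2r ?nnegrE ?r_ge2// ltW.
(* While both solutions stay in the same child their distance grows by the factor [r], so [m] drops
   by one; at [m = 0] the distance would exceed 1. *)
elim: m st inf u u' su su' um {uu'} => [|m IHm] [[s c] k] inf u u' su su' um.
  have [/andP[? ?] _] := su; have [/andP[? ?] _] := su'.
  by move: um; rewrite expr0 invr1 ltr_normr => /orP[|]; lra.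
have [d dr infd] := solutions_infinite_child inf.
have [n0 n0P] := IHj _ infd.
(* Gain by multiplication: [3 / 2 * (1 + j / 2)] is at least [1 + (j + 1) / 2]. *)
have [sE|s1] := eqVneq s (-1).
  subst s; exists n0.+1 => -[//|n] n0n; rewrite weighted_countN1.
  have := n0P n n0n; rewrite gchildN1 -(natr1 j).
  by have : 0 <= j%:R :> R by []; lra.
(* Gain by branching: a second child with a solution adds at least 1. *)
have [[d' [d'r dd' ne]]|only] := pselect (exists d',
    [/\ (d' < r)%N, d' != d & solutions (gchild (s, c, k) d') y !=set0]).
  exists n0.+1 => -[//|n] n0n; rewrite weighted_countS//.
  rewrite (bigD1 (Ordinal dr))//= (bigD1 (Ordinal d'r))//=.
  have hd : 1 + j%:R / 2 <= cnt n (gchild (s, c, k) d) y by exact: n0P.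
  have hd' := weighted_count_ge1 n ne.
  have : 0 <= \sum_(i < r | (i != Ordinal dr) && (i != Ordinal d'r))
      cnt n (gchild (s, c, k) i) y.
    by apply: sumr_ge0 => i _; exact/weighted_count_ge0/gweight_ge0.
  by move: hd hd'; rewrite /= -(natr1 j); lra.
have in_d v : solutions (s, c, k) y v ->
    exists2 t, v = branch r d t & solutions (gchild (s, c, k) d) y t.
  rewrite solutionsE => -[d' /= d'r [t tP <-]].
  have [<-|dd'] := eqVneq d' d; first by exists t.
  by exfalso; apply: only; exists d'; split => //; exists t.
have [t ut st'] := in_d _ su; have [t' ut' st''] := in_d _ su'.
have [n1 n1P] : exists n0, forall n, (n0 <= n)%N ->
    1 + j.+1%:R / 2 <= cnt n (gchild (s, c, k) d) y.
  apply: IHm infd _ _ st' st'' _.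
  by move: um; rewrite ut ut' branch_dist// rkS ltr_pM2r ?invr_gt0.
exists n1.+1 => -[//|n] n1n; rewrite weighted_countS//.
rewrite (bigD1 (Ordinal dr))//=.
apply: le_trans (n1P n n1n) _; rewrite lerDl; apply: sumr_ge0 => i _.
exact/weighted_count_ge0/gweight_ge0.
Qed.

(** This is the value of [takagi r] at [1/2], the increment of [profile] over [[0, 1]]; [driftE] is
    the functional equation at that point. *)
Definition drift : R := r%:R / (2 * (r%:R - (odd r)%:R)).

(* [|s| / 2 +- drift] is [|F 1 - F 0|] for [F = sloped s] (up to sign), so it is
   harmonic for the slope walk away from [s = -1]. *)
Definition potential s : R :=
  `|s|%:~R / 2 + (if 0 <= s then drift else - drift) + 2.

Lemma driftE : r%:R * drift = r%:R / 2 + (odd r)%:R * drift.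
Proof.
have : (odd r)%:R < r%:R :> R by rewrite ltr_nat; case: odd; lia.
by rewrite /drift => h; field; lra.
Qed.

Lemma drift_bounds : 2^-1 <= drift <= 3 / 4.
Proof.
have orR : 3 * (odd r)%:R <= r%:R :> R.
  rewrite -natrM ler_nat; have [h|//] := boolP (odd r).
  by move: h r2; case: r => [|[|[|n]]] //= _ _; lia.
have o0 : 0 <= (odd r)%:R :> R by [].
have h : 0 < 2 * (r%:R - (odd r)%:R) :> R.
  by rewrite mulr_gt0// subr_gt0 ltr_nat; case: odd; lia.
by rewrite /drift ler_pdivlMr// ler_pdivrMr//; apply/andP; split; lra.
Qed.

(** Away from [s = -1] equality holds by [driftE], the constant 2 being harmonic too. At [s = -1]
    the claim is [3 / (2 r) * (drift + 2) <= 5 / 2 - drift], which the constant 2 makes true. *)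
Lemma potential_superharmonic st :
  gweight st * \sum_(d < r) (r%:R ^- (gchild st d).2 * potential (gchild st d).1.1)
    <= r%:R ^- st.2 * potential st.1.1.
Proof.
move: st => [[s c] k] /=; rewrite -big_distrr/= sum_turn.
have hD := driftE; have hr0 := r0; have /andP[D0 D1] := drift_bounds.
have R2 := @r_ge2 R _ r2.
have eo : (uphalf r)%:R = (r./2)%:R + (odd r)%:R :> R.
  by rewrite uphalf_half natrD addrC.
have re : r%:R = 2 * (r./2)%:R + (odd r)%:R :> R.
  by rewrite -{1}(odd_double_half r) -muln2 natrD natrM; ring.
rewrite mulrCA rkS -mulrA ler_pM2l// ler_pdivrMl//.
rewrite /gweight /potential/=; have [->|s1] := eqVneq s (-1).
  rewrite addNr oppr0 lexx normr0 normrN1 /= mul0r add0r -mulrDl eo.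
  have -> : (r./2)%:R + (odd r)%:R + (r./2)%:R = r%:R :> R by rewrite re; ring.
  rewrite mulrA divfK ?lt0r_neq0//.
  (* For [r = 2] the bound [drift <= 3 / 4] is too weak; the exact value [1 / 2] is used. *)
  have [rE|r3] : r = 2%N \/ (3 <= r)%N by lia.
    have oE : odd r = false by rewrite rE.
    have RE : r%:R = 2 :> R by rewrite rE.
    by move: hD; rewrite oE RE mul0r addr0; lra.
  have R3 : 3 <= r%:R :> R by rewrite ler_nat.
  by nra.
rewrite mul1r; have [s0|s0] := leP 0 s.
  have -> : (0 <= s + 1) = true by lia.
  have -> : (0 <= - (s + 1)) = false by lia.
  rewrite normrN !ger0_norm ?addr_ge0// intrD eo.
  by move: hD; rewrite re; lra.
have -> : (0 <= s + 1) = false by lia.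
have -> : (0 <= - (s + 1)) = true by lia.
have sE : `|s| = - s by rewrite ltr0_norm.
have sE1 : `|s + 1| = - s - 1 by rewrite ler0_norm; lia.
rewrite normrN sE sE1 intrB eo.
by move: hD; rewrite mulrNz re; lra.
Qed.

Lemma ae_solutions_finite :
  {ae @lebesgue_measure R, forall y, finite_set (solutions (0, 0, 0%N) y)}.
Proof.
have int_le : forall n st,
    (\int[lebesgue_measure]_y (cnt n st y)%:E
      <= (r%:R ^- st.2 * potential st.1.1)%:E)%E.
  apply: (integral_weighted_count gweight_ge0 (B := fun=> _)).
  - exact: glo_le_ghi.
  - move=> [[s c] k] /=; rewrite opprD addrACA subrr add0r -mulrBr ler_pM2l//.
    have /andP[D0 D1] := drift_bounds; rewrite /potential intr_norm.
    have [s0|s0] := leP 0 s.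
      have sR : 0 <= s%:~R :> R by rewrite ler0z.
      by rewrite ger0_norm// /Num.min /Num.max; case: ltP; lra.
    have sR : s%:~R < 0 :> R by rewrite ltrz0.
    by rewrite ltr0_norm// /Num.min /Num.max; case: ltP; lra.
  - by move=> _; exact: potential_superharmonic.
have ae := @ae_not_cvgy _ _ _ (@lebesgue_measure R)
  (fun n => cnt n (0, 0, 0%N)) _ _ _ (fun n => int_le n (0, 0, 0%N)).
apply: filterS (ae _ _) => [y ny|n|n y]; last 2 first.
- exact: measurable_weighted_count.
- exact/weighted_count_ge0/gweight_ge0.
apply: contrapT => inf; apply: ny; apply/cvgryPge => A.
have [n0 n0P] := weighted_count_grows (2 * Num.truncn `|A|).+1 inf.
exists n0 => // n /= /n0P; apply: le_trans.
have := truncnS_gt `|A|; have := ler_norm A.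
by rewrite -(natr1 (2 * _)) -(natr1 (Num.truncn _)) natrM; lra.
Qed.

End level_sets_finite.

(** * Almost every point lies in an uncountable level set *)

Section recurrence.
Context {R : realType} (r : nat).
Hypothesis r2 : (2 <= r)%N.
Implicit Types (a b t u x : R) (s : int) (d : nat).

(* [(s, a, b)] stands for the interval with endpoints [a] and [a + b],
   parametrized by [t |-> a + b * t]. *)
Definition dchild (st : int * R * R) d : int * R * R :=
  let: (s, a, b) := st in
  (turn s d, a + b * (d + odd d)%:R / r%:R, b * (-1) ^+ d / r%:R).

Definition dlo (st : int * R * R) : R := Num.min st.1.2 (st.1.2 + st.2).

Definition dhi (st : int * R * R) : R := Num.max st.1.2 (st.1.2 + st.2).

(** At a point of the interval that is never a division point, the count is [2^-k], where [k] is the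
    number of visits to [-1] before time [n]. *)
Definition dweight (st : int * R * R) : R := if st.1.1 == -1 then 2^-1 else 1.

Local Notation cnt := (weighted_count r dweight dlo dhi dchild).

Let r0 : 0 < r%:R :> R. Proof. exact: r_gt0. Qed.

Lemma dweight_itv st : 2^-1 <= dweight st <= 1.
Proof. by rewrite /dweight; case: ifP => _; apply/andP; split; lra. Qed.

Lemma dweight_ge0 st : 0 <= dweight st.
Proof. by have /andP[] := dweight_itv st; lra. Qed.

(** * Recurrence of the slope walk *)

(* The expectation of [2^-k], [k] being the number of visits of the slope walk
   to [-1] before time [n]. *)
Fixpoint discount n s : R :=
  if n is n'.+1 then
    (if s == -1 then 2^-1 else 1) / r%:R * \sum_(d < r) discount n' (turn s d)
  else 1.

Lemma discount_ge0 n s : 0 <= discount n s.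
Proof.
elim: n s => [//|n IHn] s /=.
by rewrite mulr_ge0 ?sumr_ge0// divr_ge0 ?ler0n//; case: ifP.
Qed.

Lemma discount_nonincreasing n s : discount n.+1 s <= discount n s.
Proof.
elim: n s => [|n IHn] s.
  rewrite /= sumr_const card_ord divfK ?lt0r_neq0//.
  by case: ifP => _; lra.
rewrite [discount n.+2 s]/= [X in _ <= X]/= ler_wpM2l//.
  by rewrite divr_ge0 ?ler0n//; case: ifP.
by apply: ler_sum => d _; exact: IHn.
Qed.

Lemma discount_le1 n s : discount n s <= 1.
Proof.
elim: n => [//|n]; apply: le_trans; exact: discount_nonincreasing.
Qed.

(** With [D = L 1 - L (-1)], the relations make [L] linear along the negative integers with
    increment [q * D]; boundedness forces [D = 0]. Then [L 0 = L (-1) = L 0 / 2], so everything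
    vanishes. *)
Lemma bounded_harmonic_eq0 (p q : R) (L : int -> R) :
  0 < p -> 0 < q -> p + q = 1 ->
  (forall s, 0 <= L s <= 1) -> L (-1) = L 0 / 2 ->
  (forall s, s != -1 -> L s = p * L (s + 1) + q * L (- (s + 1))) ->
  forall s, L s = 0.
Proof.
move=> p0 q0 pq L01 LN1 LS.
have up (n : nat) : L n%:Z = p * L (n.+1)%:Z + q * L (- (n.+1)%:Z).
  by rewrite LS; [have -> : n%:Z + 1 = n.+1 by lia|lia].
have down (n : nat) : L (- (n.+2)%:Z) = p * L (- (n.+1)%:Z) + q * L (n.+1)%:Z.
  rewrite LS; last by lia.
  have -> : - (n.+2)%:Z + 1 = - (n.+1)%:Z by lia.
  by rewrite opprK.
pose D := L 1 - L (-1).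
have lin (n : nat) : L (n.+1)%:Z - L (- (n.+1)%:Z) = D /\
    L (- (n.+1)%:Z) = L (-1) + n%:R * (q * D).
  elim: n => [|n [IH1 IH2]]; first by rewrite mul0r addr0.
  have u := up n.+1; have dn := down n.
  have e : L (- (n.+2)%:Z) = L (-1) + n.+1%:R * (q * D).
    have aE : L (n.+1)%:Z = L (- (n.+1)%:Z) + D by lra.
    rewrite dn aE mulrDr addrA -mulrDl pq mul1r IH2.
    by rewrite -(natr1 n) mulrDl mul1r addrA.
  split=> //; apply: (mulfI (lt0r_neq0 p0)).
  have qE : q = 1 - p by lra.
  by move: u dn IH1; rewrite qE; nra.
have D0 : D = 0.
  apply/eqP; rewrite -normr_le0 leNgt; apply/negP => Dgt0.
  have qD : 0 < q * `|D| by rewrite mulr_gt0.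
  have := truncnS_gt (q * `|D|)^-1.
  rewrite -(@ltr_pM2r _ (q * `|D|))// mulVf ?lt0r_neq0//.
  set n := (Num.truncn _).+1; have [_] := lin n.
  move/(congr1 (fun z => `|z - L (-1)|)); rewrite addrAC subrr add0r.
  rewrite !normrM normr_nat (gtr0_norm q0) => <-.
  rewrite ltr_normr; have /andP[? ?] := L01 (-1).
  by have /andP[? ?] := L01 (- (n.+1)%:Z); case/orP; lra.
have L0 : L 0 = 0.
  have := up 0%N; have := lin 0%N; rewrite D0 LN1 => -[+ _].
  by nra.
have Lpos (n : nat) : L (n.+1)%:Z = 0 /\ L (- (n.+1)%:Z) = 0.
  by have := lin n; rewrite D0 LN1 L0 !mulr0 => -[]; lra.
case=> [[|n]|n]; [exact: L0|exact: (Lpos n).1|].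
by rewrite NegzE; exact: (Lpos n).2.
Qed.

(** The limit exists by monotonicity and inherits the recursion, so it is a bounded harmonic
    function of the kind just excluded. *)
Lemma discount_cvg0 s : discount^~ s @ \oo --> (0 : R).
Proof.
have cvg s' : cvgn (discount^~ s').
  apply: nonincreasing_is_cvgn.
    by apply/nonincreasing_seqP => n; exact: discount_nonincreasing.
  by exists 0 => _ [n _ <-]; exact: discount_ge0.
suff <- : limn (discount^~ s) = 0 by exact: cvg.
have eo : (uphalf r)%:R + (r./2)%:R = r%:R :> R.
  by rewrite -natrD uphalf_half -addnA addnn odd_double_half.
have rec s' : limn (discount^~ s') = (if s' == -1 then 2^-1 else 1) *
    ((uphalf r)%:R / r%:R * limn (discount^~ (s' + 1)) +
     (r./2)%:R / r%:R * limn (discount^~ (- (s' + 1)))).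
  apply: cvg_lim => //; rewrite -(cvg_shiftS (discount^~ s')).
  have -> : (fun n => discount n.+1 s') = (fun n => (if s' == -1 then 2^-1 else 1) *
    ((uphalf r)%:R / r%:R * discount n (s' + 1) +
     (r./2)%:R / r%:R * discount n (- (s' + 1)))).
    by apply/funext => n; rewrite /= sum_turn; ring.
  apply: cvgM; first exact: cvg_cst.
  by apply: cvgD; (apply: cvgM; [exact: cvg_cst|exact: cvg]).
apply: (@bounded_harmonic_eq0 ((uphalf r)%:R / r%:R) ((r./2)%:R / r%:R)
  (fun s => limn (discount^~ s))).
- by rewrite divr_gt0// ltr0n uphalf_half; lia.
- by rewrite divr_gt0// ltr0n; lia.
- by rewrite -mulrDl eo divff// lt0r_neq0.
- move=> s'; apply/andP; split.
    by apply: limr_ge; [exact: cvg|apply: nearW => n; exact: discount_ge0].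
  by apply: limr_le; [exact: cvg|apply: nearW => n; exact: discount_le1].
- rewrite rec eqxx addNr oppr0 -mulrDl -mulrDl eo divff ?lt0r_neq0//.
  by rewrite mul1r mulrC.
- by move=> s' s1; rewrite rec (negPf s1) mul1r.
Qed.

(** For [x] in the interval of [st], this encodes infinitely many visits to [-1] without choosing an
    itinerary at division points. *)
Definition low st x := forall e : R, 0 < e -> exists n, cnt n st x < e.

Lemma ae_low st : {ae @lebesgue_measure R, forall x, low st x}.
Proof.
have int_le n st' :
    (\int[lebesgue_measure]_x (cnt n st' x)%:E
      <= (`|st'.2| * discount n st'.1.1)%:E)%E.
  move: n st'; apply: (integral_weighted_count dweight_ge0
    (B := fun n st => `|st.2| * discount n st.1.1)).
  - by move=> st'; rewrite /dlo /dhi ge_min le_max lexx.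
  - move=> st'; rewrite /dlo /dhi mulr1 /Num.min /Num.max ler_normr.
    by apply/orP; case: ifPn; lra.
  - move=> n [[s a] b] /=; rewrite /dweight/=.
    rewrite (eq_bigr (fun d : 'I_r => `|b| / r%:R * discount n (turn s d))).
      by rewrite -big_distrr/= le_eqVlt; apply/orP; left; apply/eqP; ring.
    by move=> d _; rewrite normrM normfV normr_nat normrM normrX normrN1 expr1n mulr1.
have ae := @ae_liminf0 _ _ _ (@lebesgue_measure R)
  (fun n => cnt n st) _ _ _ (fun n => int_le n st).
apply: ae => [n|n x|].
- exact: measurable_weighted_count.
- exact/weighted_count_ge0/dweight_ge0.
- rewrite -(mulr0 `|st.2|); apply: cvgM; first exact: cvg_cst.
  exact: discount_cvg0.
Qed.

(** * Segments and affine copies of graph pieces *)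

Definition segment (st : int * R * R) : set R :=
  [set st.1.2 + st.2 * t | t in [set t | 0 <= t <= 1]].

Lemma segmentP st x : st.2 != 0 -> segment st x <-> dlo st <= x <= dhi st.
Proof.
move: st => [[s a] b] /= b0; rewrite /segment /dlo /dhi/=; split.
  move=> [t /andP[t0 t1] <-]; rewrite ge_min le_max.
  by have [bp|bn] := leP 0 b; apply/andP; split; apply/orP; nra.
move=> h; exists ((x - a) / b); last by field.
move: h; have [bn|bp] := ltP b 0.
  rewrite min_r ?max_l; [|lra|lra].
  by rewrite ler_ndivlMr// ler_ndivrMr// mul0r mul1r; lra.
have {b0}bp : 0 < b by rewrite lt_neqAle eq_sym b0.
rewrite min_l ?max_r; [|lra|lra].
by rewrite ler_pdivlMr// ler_pdivrMr// mul0r mul1r; lra.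
Qed.

Lemma dchild_neq0 b d : b != 0 -> b * (-1) ^+ d / r%:R != 0.
Proof. by move=> b0; rewrite !mulf_eq0 signr_eq0 invr_eq0 !negb_or b0 lt0r_neq0. Qed.

Lemma weighted_count_affine n s a b a' b' t : b != 0 -> b' != 0 ->
  cnt n (s, a, b) (a + b * t) = cnt n (s, a', b') (a' + b' * t).
Proof.
have one s1 a1 b1 u : b1 != 0 ->
    (dlo (s1, a1, b1) <= a1 + b1 * u <= dhi (s1, a1, b1)) = (0 <= u <= 1).
  move=> b10; apply/idP/idP => [|u01].
    by move/(segmentP (st := (s1, a1, b1)) _ b10) => -[u' + /= /addrI/(mulfI b10) <-].
  by apply/(segmentP (st := (s1, a1, b1)) _ b10); exists u.
elim: n s a b a' b' t => [|n IHn] s a b a' b' t b0 b'0.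
  by rewrite !weighted_count0 !one.
rewrite !weighted_count_succ; congr (_ * _); apply: eq_bigr => d _.
(* The coordinate of the same point in the [d]-th child, that is [branch r d t' = t]. *)
pose t' := (-1) ^+ d * (r%:R * t - (d + odd d)%:R).
have tE a1 b1 : a1 + b1 * t =
    a1 + b1 * (d + odd d)%:R / r%:R + b1 * (-1) ^+ d / r%:R * t'.
  have -> : b1 * (-1) ^+ d / r%:R * t' =
      b1 / r%:R * ((-1) ^+ d * (-1) ^+ d) * (r%:R * t - (d + odd d)%:R).
    by rewrite /t'; ring.
  by rewrite -expr2 sqrr_sign; field; rewrite lt0r_neq0.
by rewrite !tE /dchild; apply: IHn; exact: dchild_neq0.
Qed.

Lemma weighted_count0_unit s t : 0 <= t <= 1 -> cnt 0 (s, 0, 1) t = 1.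
Proof.
move=> t01; rewrite weighted_count0.
suff -> : dlo (s, 0, 1) <= t <= dhi (s, 0, 1) by [].
by apply/segmentP; [exact: oner_neq0|exists t; rewrite //= add0r mul1r].
Qed.

Lemma weighted_count_dchild n s d t :
  cnt n (dchild (s, 0, 1) d) (branch r d t) = cnt n (turn s d, 0, 1) t.
Proof.
have -> : branch r d t = (0 + 1 * (d + odd d)%:R / r%:R) + 1 * (-1) ^+ d / r%:R * t.
  by rewrite /branch; ring.
rewrite (weighted_count_affine _ _ _ 0 _ (b' := 1)) ?dchild_neq0 ?oner_neq0//.
by rewrite add0r mul1r.
Qed.

Lemma low_branch s t d : (d < r)%N -> 0 <= t <= 1 ->
  low (s, 0, 1) (branch r d t) -> low (turn s d, 0, 1) t.
Proof.
(* The bound 1 excludes [n = 0], and the factor [2^-1] pays for the weight of the parent. *)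
move=> dr t01 lo e e0; have [|[|n]] := lo (Num.min 1 (2^-1 * e)).
- by rewrite lt_min ltr01 mulr_gt0// invr_gt0.
- by rewrite weighted_count0_unit ?branch_itv// lt_min ltxx.
rewrite weighted_count_succ lt_min (bigD1 (Ordinal dr))// => /andP[_].
rewrite [nat_of_ord _]/= weighted_count_dchild => hn; exists n.
set rest := \sum_(i < r | _) _ in hn.
have {}hn : dweight (s, 0, 1) * (cnt n (turn s d, 0, 1) t + rest) < 2^-1 * e := hn.
have rest0 : 0 <= rest.
  by apply: sumr_ge0 => i _; exact/weighted_count_ge0/dweight_ge0.
have /andP[w2 _] := dweight_itv (s, 0, 1).
have c0 := weighted_count_ge0 r dlo dhi dchild dweight_ge0 n (turn s d, 0, 1) t.
have : 2^-1 * (cnt n (turn s d, 0, 1) t + rest)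
    <= dweight (s, 0, 1) * (cnt n (turn s d, 0, 1) t + rest).
  by rewrite ler_wpM2r// addr_ge0.
by lra.
Qed.

Definition copy st := [/\ st.2 != 0, segment st `<=` [set u | 0 <= u <= 1] &
  exists c, forall t, 0 <= t <= 1 ->
    profile r (st.1.2 + st.2 * t) = c + `|st.2| * sloped r st.1.1 t].

Lemma dchild_branch s a b d t :
  (dchild (s, a, b) d).1.2 + (dchild (s, a, b) d).2 * t = a + b * branch r d t.
Proof. by rewrite /branch/=; ring. Qed.

Lemma segment_dchild st d : (d < r)%N -> segment (dchild st d) `<=` segment st.
Proof.
move: st => [[s a] b] dr _ [t /= t01 <-].
exists (branch r d t); first exact: branch_itv.
by rewrite -(dchild_branch s).
Qed.

Lemma copy_dchild st d : (d < r)%N -> copy st -> copy (dchild st d).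
Proof.
move: st => [[s a] b] dr [/= b0 sub [c cP]]; split => /=.
- exact: dchild_neq0.
- exact: subset_trans (segment_dchild dr) sub.
- exists (c + `|b| * ((s + 1)%:~R * (d + odd d)%:R / (2 * r%:R))) => t t01.
  have := dchild_branch s a b d t; rewrite /= => ->.
  rewrite cP ?branch_itv// sloped_branch// normrM normfV normr_nat normrM.
  by rewrite normrX normrN1 expr1n mulr1; ring.
Qed.

(** * Transplanting itineraries inside a level set *)

Variable y : R.

(* A copy of [sloped s] containing a point of the level set [y] whose slope
   walk visits [-1] infinitely often. *)
Definition piece st := copy st /\ exists t, [/\ 0 <= t <= 1,
  profile r (st.1.2 + st.2 * t) = y & low (st.1.1, 0, 1) t].

Lemma piece_branch s a b d t : (d < r)%N -> 0 <= t <= 1 -> copy (s, a, b) ->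
  profile r (a + b * branch r d t) = y -> low (s, 0, 1) (branch r d t) ->
  piece (dchild (s, a, b) d).
Proof.
move=> dr t01 cst yE lst; split; first exact: copy_dchild.
by exists t; split => //; [rewrite dchild_branch|exact: (low_branch dr t01 lst)].
Qed.

(** On the [d]-th child [sloped r (-1)] equals [sloped r 0 t / r] for every [d], so the marked point
    can be moved from its own child to any other. *)
Lemma piece_dchildN1 a b d : (d < r)%N -> piece (-1, a, b) ->
  piece (dchild (-1, a, b) d).
Proof.
move=> dr [cst [u [u01 yE lst]]].
have [d' [t [d'r t01 uE]]] := branch_surj r2 u01.
have [_ _ [c cP]] := cst.
split; first exact: copy_dchild.
exists t; split => //.
  rewrite dchild_branch -yE uE /= !cP ?branch_itv//.
  by rewrite !sloped_branch// !turnN1 addNr !mul0r.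
by have := low_branch d'r t01 (s := -1); rewrite -uE /= !turnN1; exact.
Qed.

(** Along the itinerary of the marked point the count stays at least 1 until [-1] is met, whereas
    [low] gives some [n] with count below 1. *)
Lemma piece_return st : piece st -> exists st', [/\ piece st', st'.1.1 = -1,
  segment st' `<=` segment st & `|st'.2| <= `|st.2|].
Proof.
move=> [cst [t [t01 yE lst]]]; have [n] := lst 1 ltr01.
elim: n st t t01 cst yE lst => [|n IHn] [[s a] b] t t01 cst yE lst.
  by rewrite weighted_count0_unit// ltxx.
have [sE _|s1] := eqVneq s (-1).
  by exists (s, a, b); split => //; split => //; exists t.
have [d [t' [dr t'01 tE]]] := branch_surj r2 t01.
rewrite /= in yE lst; rewrite tE in yE lst *.
have w1 : dweight (s, 0, 1) = 1 by rewrite /dweight (negPf s1).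
move=> cnt1; have {cnt1} : cnt n.+1 (s, 0, 1) (branch r d t') < 1 by [].
rewrite weighted_count_succ w1 mul1r (bigD1 (Ordinal dr))//.
rewrite [nat_of_ord _]/= weighted_count_dchild => cnt1.
have [||||st' [pst' s' sub le]] := IHn (dchild (s, a, b) d) _ t'01.
- exact: copy_dchild.
- by rewrite dchild_branch.
- exact: low_branch lst.
- apply: le_lt_trans cnt1; rewrite lerDl.
  by apply: sumr_ge0 => i _; exact/weighted_count_ge0/dweight_ge0.
exists st'; split => //; first exact: subset_trans sub (segment_dchild dr).
apply: le_trans le _; rewrite /= normrM normfV normr_nat normrM normrX normrN1.
rewrite expr1n mulr1 ler_pdivrMr// ler_peMr//.
by have := @r_ge2 R _ r2; lra.
Qed.

(** Children 0 and 1 meet only at [a + b / r], so one of them misses [x]. *)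
Lemma piece_avoid_dichotomy a b x : piece (-1, a, b) -> x <> a + b / r%:R ->
  exists st', [/\ piece st', st'.1.1 = 0, segment st' `<=` segment (-1, a, b),
    `|st'.2| <= `|b| / r%:R & ~ segment st' x].
Proof.
move=> pst xE.
have nb d : `|(dchild (-1, a, b) d).2| <= `|b| / r%:R.
  by rewrite /= normrM normfV normr_nat normrM normrX normrN1 expr1n mulr1.
have ok d : (d < r)%N -> ~ segment (dchild (-1, a, b) d) x ->
    exists st', [/\ piece st', st'.1.1 = 0, segment st' `<=` segment (-1, a, b),
      `|st'.2| <= `|b| / r%:R & ~ segment st' x].
  move=> dr nx; exists (dchild (-1, a, b) d); split => //.
  - exact: piece_dchildN1.
  - by rewrite /= turnN1.
  - exact: segment_dchild.
have [x0|x0] := pselect (segment (dchild (-1, a, b) 0) x); last first.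
  by apply: ok x0; lia.
have [x1|x1] := pselect (segment (dchild (-1, a, b) 1) x); last first.
  by apply: ok x1; lia.
exfalso; apply: xE; have [[/= b0 _ _] _] := pst.
move: x0 x1 => [t /andP[t0 t1] tE] [u /andP[u0 u1] uE].
have {}tE : a + b / r%:R * t = x by rewrite -tE /=; ring.
have {}uE : a + b / r%:R * (2 - u) = x by rewrite -uE /=; ring.
have br0 : b / r%:R != 0 by rewrite mulf_eq0 negb_or b0 invr_eq0 lt0r_neq0.
have tu : t = 2 - u by apply: (mulfI br0); apply: (@addrI _ a); rewrite tE uE.
have t1E : t = 1 by lra.
by rewrite -tE t1E mulr1.
Qed.

Lemma piece_avoid st x : piece st -> exists st', [/\ piece st', st'.1.1 = 0,
  segment st' `<=` segment st, `|st'.2| <= `|st.2| / r%:R & ~ segment st' x].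
Proof.
move=> /piece_return[[[s a] b] [pst1 /= sE sub1 le1]]; subst s.
have [xE|xE] := pselect (x = a + b / r%:R); last first.
  have [st' [p' s' sub' le' nx]] := piece_avoid_dichotomy pst1 xE.
  exists st'; split => //; first exact: subset_trans sub1.
  by apply: le_trans le' _; rewrite ler_pM2r// invr_gt0.
have dr : (0 < r)%N by lia.
have dE : dchild (-1, a, b) 0 = (0, a, b / r%:R).
  by rewrite /dchild turnN1 mulr0 mul0r addr0 expr0 mulr1.
have sub0 := segment_dchild (st := (-1, a, b)) dr.
have := piece_dchildN1 dr pst1; rewrite {}dE in sub0 *.
move=> /piece_return[[[s a2] b2] [pst2 /= sE sub2 le2]]; subst s.
(* If [x] is the bad point, it is an endpoint of child 0. The bad point of a later segment inside
   that child is interior to the segment, so it differs from [x]. *)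
have xE2 : x <> a2 + b2 / r%:R.
  rewrite xE => x2; have [[/= b2n0 _ _] _] := pst2; have [[/= b0 _ _] _] := pst1.
  have [|t0 /= /andP[t00 t01] e0] := sub2 a2.
    by exists 0; rewrite /= ?lexx ?ler01// mulr0 addr0.
  have [|t1 /= /andP[t10 t11] e1] := sub2 (a2 + b2).
    by exists 1; rewrite /= ?lexx ?ler01// mulr1.
  have br0 : b / r%:R != 0 by rewrite mulf_eq0 negb_or b0 invr_eq0 lt0r_neq0.
  pose q : R := r%:R^-1.
  have q0 : 0 < q by rewrite invr_gt0.
  have q1 : q < 1 by rewrite invf_lt1// ltr1n.
  have b2E : b2 = b / r%:R * (t1 - t0) by rewrite mulrBr; lra.
  have qE : (1 - q) * (1 - t0) + q * (1 - t1) = 0.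
    apply: (mulfI br0); move: x2; rewrite -e0 b2E -/q; lra.
  have t0E : t0 = 1 by nra.
  have t1E : t1 = 1 by nra.
  by move: b2n0; rewrite b2E t0E t1E subrr mulr0 eqxx.
have [st' [p' s' sub' le' nx]] := piece_avoid_dichotomy pst2 xE2.
exists st'; split => //.
  by apply: subset_trans sub' _; apply: subset_trans sub2 _; exact: subset_trans sub1.
apply: le_trans le' _; rewrite ler_pM2r ?invr_gt0//; apply: le_trans le2 _.
rewrite normrM normfV normr_nat ler_pdivrMr//; apply: le_trans le1 _.
by rewrite ler_peMr//; have := @r_ge2 R _ r2; lra.
Qed.

(** Nested pieces avoid [e 0], [e 1], and so on in turn; their lengths tend to 0 and their common
    point keeps the value [y]. *)
Lemma piece_uncountable st (e : nat -> R) : piece st ->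
  exists u, [/\ 0 <= u <= 1, profile r u = y & forall n, u <> e n].
Proof.
move=> pst.
have [next nextP] : exists next : nat * (int * R * R) -> int * R * R,
    forall p, piece p.2 -> [/\ piece (next p), (next p).1.1 = 0,
      segment (next p) `<=` segment p.2, `|(next p).2| <= `|p.2.2| / r%:R &
      ~ segment (next p) (e p.1)].
  have /choice[next nP] : forall p, exists st', piece p.2 ->
      [/\ piece st', st'.1.1 = 0, segment st' `<=` segment p.2,
        `|st'.2| <= `|p.2.2| / r%:R & ~ segment st' (e p.1)].
    move=> p; have [/(@piece_avoid _ (e p.1))[st' h]|np] := pselect (piece p.2).
      by exists st'.
    by exists p.2.
  by exists next.
pose sq := fix sq n := if n is m.+1 then next (m, sq m) else st.
have sqP n : piece (sq n) by elim: n => [//|n /(nextP (n, sq n))[]].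
have seg_sub n m : (n <= m)%N -> segment (sq m) `<=` segment (sq n).
  move=> /subnKC <-; elim: (m - n)%N => [|k IHk]; first by rewrite addn0.
  rewrite addnS; apply: subset_trans IHk.
  by have [_ _ sub _ _] := nextP ((n + k)%N, sq (n + k)%N) (sqP _).
have sq0 n : (sq n).2 != 0 by have [[]] := sqP n.
have sq_small n : `|(sq n).2| <= `|st.2| * r%:R ^- n.
  elim: n => [|n IHn]; first by rewrite expr0 invr1 mulr1.
  have [_ _ _ le _] := nextP (n, sq n) (sqP n).
  have rS : r%:R ^- n.+1 = r%:R ^- n / r%:R :> R by rewrite exprSr invfM mulrC.
  by apply: le_trans le _; rewrite rS mulrA ler_pM2r// invr_gt0.
have aP n : segment (sq n) (sq n).1.2.
  by exists 0; rewrite /= ?lexx ?ler01// mulr0 addr0.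
have bnd m n : dlo (sq m) <= dhi (sq n).
  have h := aP (maxn m n).
  have /segmentP-/(_ (sq0 _))/andP[h1 _] := seg_sub _ _ (leq_maxl m n) _ h.
  have /segmentP-/(_ (sq0 _))/andP[_ h2] := seg_sub _ _ (leq_maxr m n) _ h.
  exact: le_trans h1 h2.
pose u := sup (range (fun n => dlo (sq n))).
have uP n : segment (sq n) u.
  apply/segmentP => //; apply/andP; split.
    apply: (ub_le_sup (E := range (fun n => dlo (sq n)))); last by exists n.
    by exists (dhi (sq 0%N)) => _ [m _ <-].
  by apply: ge_sup; [exists (dlo (sq 0%N)), 0%N|move=> _ [m _ <-]].
exists u; split.
- by have [[_ sub _] _] := sqP 0%N; exact: sub.
- apply/eqP; rewrite -subr_eq0 -normr_le0; apply/ler_addgt0Pr => eps eps0.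
  rewrite add0r; have st0 : 0 < `|st.2| by rewrite normr_gt0; exact: sq0 0%N.
  have d0 : 0 < eps / `|st.2| by rewrite divr_gt0.
  have [n _ /(_ n (leqnn n)) /= hn] := near_infty_natSinv_expn_lt (PosNum d0).
  have bn : `|(sq n.+1).2| <= eps.
    apply: le_trans (sq_small n.+1) _; rewrite mulrC -ler_pdivlMr//.
    apply: le_trans (ltW hn); rewrite mul1r lef_pV2 ?posrE ?exprn_gt0//.
    apply: (@le_trans _ _ (r%:R ^+ n)).
      by rewrite lerXn2r ?nnegrE ?r_ge2// ltW.
    by rewrite ler_weXn2l//; have := @r_ge2 R _ r2; lra.
  have [_ s0 _ _ _] := nextP (n, sq n) (sqP n).
  have [[_ _ [c cP]] [t' [t'01 yE _]]] := sqP n.+1.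
  have [t t01 uE] := uP n.+1.
  (* Since the slope state is 0, the value at [u] differs from [y] by at most the length of the
     segment. *)
  rewrite -yE -uE !cP// [(sq n.+1).1.1]s0 /sloped !mul0r !add0r.
  rewrite opprD addrACA subrr add0r -mulrBr normrM normr_id.
  apply: le_trans bn; rewrite ler_piMr//.
  have := profile_ge0 r2 t; have := profile_le1 r2 t.
  have := profile_ge0 r2 t'; have := profile_le1 r2 t'.
  by rewrite ler_norml => *; apply/andP; split; lra.
- move=> n uE; have [_ _ _ _ nx] := nextP (n, sq n) (sqP n).
  by apply: nx; rewrite -uE; exact: uP n.+1.
Qed.

End recurrence.

(** * Transfer to [takagi] by doubling and reflection *)

Section main.
Context {R : realType} (r : nat).
Hypothesis r2 : (2 <= r)%N.

Lemma profile_double (x : R) : profile r (2 * x) = takagi r x.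
Proof. by rewrite /profile mulrAC divff ?mul1r. Qed.

Lemma takagi_onem (x : R) : takagi r (1 - x) = takagi r x.
Proof. by rewrite addrC (takagiDz _ _ 1) takagiN. Qed.

Lemma ae_level_set_finite :
  {ae @lebesgue_measure R, forall y, finite_set (level_set r y)}.
Proof.
have F := ae_filter_ringOfSetsType (@lebesgue_measure R).
apply: filterS (ae_solutions_finite r2) => y fin.
have solE t : 0 <= t <= 1 -> profile r t = y -> solutions r (0, 0, 0%N) y t.
  by move=> t01 tE; split=> //; rewrite /sloped /= !mul0r !add0r expr0 invr1 mul1r.
apply: (@sub_finite_set _ _ ([set t / 2 | t in solutions r (0, 0, 0%N) y] `|`
    [set 1 - t / 2 | t in solutions r (0, 0, 0%N) y])); last first.
  by rewrite finite_setU; split; exact: finite_image.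
move=> x [/andP[x0 x1] xE]; have [x_le|x_gt] := leP x 2^-1.
  left; exists (2 * x); last by field.
  by apply: solE; [apply/andP; split; lra|rewrite profile_double].
right; exists (2 * (1 - x)); last by field.
by apply: solE; [apply/andP; split; lra|rewrite profile_double takagi_onem].
Qed.

Lemma level_set_uncountable (t y : R) : 0 <= t <= 1 -> profile r t = y ->
  low r (0, 0, 1) t -> ~ countable (level_set r y).
Proof.
move=> t01 tE lt /countable_injP[f finj].
have pst : piece r y (0, 0, 1).
  split; last by exists t; split => //; rewrite /= add0r mul1r.
  split; first exact: oner_neq0.
    by move=> _ [u u01 <-]; rewrite /= add0r mul1r.
  exists 0 => u u01.
  by rewrite /= !add0r !mul1r normr1 mul1r /sloped !mul0r add0r.
pose e n : R := 2 * xget 0 [set x | level_set r y x /\ f x = n].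
have [u [/andP[u0 u1] uE ne]] := piece_uncountable r2 e pst.
have Lu : level_set r y (u / 2).
  by split; [apply/andP; split; lra|rewrite -profile_double mulrC divfK].
apply: (ne (f (u / 2))); rewrite /e.
case: xgetP => [x _ [Lx fx]|/(_ (u / 2))]; last by case.
by rewrite (finj x (u / 2)) ?inE// mulrC divfK.
Qed.

Lemma ae_level_set_uncountable :
  {ae @lebesgue_measure R, forall x,
    0 <= x < 1 -> ~ countable (level_set r (takagi r x))}.
Proof.
have n2 : 2^-1 != 0 :> R by rewrite invr_eq0.
have F := ae_filter_ringOfSetsType (@lebesgue_measure R).
(* The two starting states parametrize [[0, 1/2]] and the reflected [[1/2, 1]] directly in [x], so
   no null set has to be carried through [x |-> 2 x]. *)
apply: filterS2 (ae_low r2 (0, 0, 2^-1)) (ae_low r2 (0, 1, - 2^-1)) => x lx lx'.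
move=> /andP[x0 x1]; have [x_le|x_gt] := leP x 2^-1.
  apply: (@level_set_uncountable (2 * x)); first by apply/andP; split; lra.
    exact: profile_double.
  move=> eps /lx[n hn]; exists n; apply: le_lt_trans hn.
  have := weighted_count_affine r2 n 0 0 0 (2 * x) n2 (oner_neq0 _).
  by rewrite !add0r mul1r mulKf// => ->.
apply: (@level_set_uncountable (2 * (1 - x))); first by apply/andP; split; lra.
  by rewrite profile_double takagi_onem.
move=> eps /lx'[n hn]; exists n; apply: le_lt_trans hn.
have n2' : - 2^-1 != 0 :> R by rewrite oppr_eq0.
have := weighted_count_affine r2 n 0 1 0 (2 * (1 - x)) n2' (oner_neq0 _).
rewrite add0r mul1r => <-.
by have -> : 1 + - 2^-1 * (2 * (1 - x)) = x by field.
Qed.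

End main.

Unset Implicit Arguments.

Theorem theorem1p1 (R : realType) :
  (forall r : nat, (2 <= r)%N ->
     {ae (@lebesgue_measure R), forall y : R, finite_set (level_set r y)}) /\
  (forall r : nat, (2 <= r)%N ->
     {ae (@lebesgue_measure R), forall x : R,
        0 <= x < 1 -> ~ countable (level_set r (takagi r x))}).
Proof.
by split=> r r2; [exact: ae_level_set_finite|exact: ae_level_set_uncountable].
Qed.
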